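(* Let $d\in\{2,3\}$, let $U$ be either the cube $I^d$ or the simplex $\Delta^d$, let $p\ge 1$ be an integer, and let $F:U\to\mathbb{R}^d$ be a polynomial function of degree at most $p$ (degree at most $p$ in each individual coordinate if $U=I^d$, total degree at most $p$ if $U=\Delta^d$). Let $G_\xi,G_\eta$ (and $G_\zeta$ if $d=3$) be the lists of Bernstein-Bézier control points of the partial derivatives of $F$. Assume that: if $d=2$, the matrix $[\mathbf{u},\mathbf{v}]$ with columns $\mathbf{u},\mathbf{v}$ is invertible for every $\mathbf{u}\in\operatorname{hull}(G_\xi)$ and every $\mathbf{v}\in\operatorname{hull}(G_\eta)$; if $d=3$, the matrix $[\mathbf{u},\mathbf{v},\mathbf{w}]$ is invertible for every $\mathbf{u}\in\operatorname{hull}(G_\xi)$, $\mathbf{v}\in\operatorname{hull}(G_\eta)$, $\mathbf{w}\in\operatorname{hull}(G_\zeta)$. Then $F$ is globally invertible on $U$; that is, $F$ is injective on $U$ and its inverse $G:F(U)\to U$, defined by $G(F(\mathbf{x}))=\mathbf{x}$ for $\mathbf{x}\in U$, is smooth.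
   Context: $\operatorname{hull}$ denotes convex hull. $I^d=[0,1]^d$; $\Delta^2=\{(\xi,\eta):\xi,\eta\ge 0,\ \xi+\eta\le 1\}$; $\Delta^3=\{(\xi,\eta,\zeta):\xi,\eta,\zeta\ge 0,\ \xi+\eta+\zeta\le 1\}$. A map on the (not necessarily open) set $F(U)\subset\mathbb{R}^d$ is smooth if near each point of $F(U)$ it agrees on $F(U)$ with a $C^\infty$ map defined on an open neighbourhood of that point in $\mathbb{R}^d$. Bernstein-Bézier (BB) form: $F$ is written uniquely with control points $\mathbf{f}_{i,j}\in\mathbb{R}^2$ or $\mathbf{f}_{i,j,k}\in\mathbb{R}^3$ as follows. On $I^2$: $F(\xi,\eta)=\sum_{i=0}^p\sum_{j=0}^p \mathbf{f}_{i,j}\binom{p}{i}\binom{p}{j}(1-\xi)^{p-i}\xi^i(1-\eta)^{p-j}\eta^j$. On $I^3$: $F(\xi,\eta,\zeta)=\sum_{i,j,k=0}^p \mathbf{f}_{i,j,k}\binom{p}{i}\binom{p}{j}\binom{p}{k}(1-\xi)^{p-i}\xi^i(1-\eta)^{p-j}\eta^j(1-\zeta)^{p-k}\zeta^k$. On $\Delta^2$: $F(\xi,\eta)=\sum_{i,j\ge 0,\,i+j\le p}\mathbf{f}_{i,j}\frac{p!}{i!\,j!\,(p-i-j)!}\xi^i\eta^j(1-\xi-\eta)^{p-i-j}$. On $\Delta^3$: $F(\xi,\eta,\zeta)=\sum_{i,j,k\ge 0,\,i+j+k\le p}\mathbf{f}_{i,j,k}\frac{p!}{i!\,j!\,k!\,(p-i-j-k)!}\xi^i\eta^j\zeta^k(1-\xi-\eta-\zeta)^{p-i-j-k}$.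 $G_\xi$ is the finite list of all vectors $p(\mathbf{f}_{i+1,j}-\mathbf{f}_{i,j})$ (for $d=2$) or $p(\mathbf{f}_{i+1,j,k}-\mathbf{f}_{i,j,k})$ (for $d=3$), over all indices for which both control points are defined; these are the BB control points of $\partial F/\partial\xi$. Similarly $G_\eta$ consists of all vectors $p(\mathbf{f}_{i,j+1}-\mathbf{f}_{i,j})$ or $p(\mathbf{f}_{i,j+1,k}-\mathbf{f}_{i,j,k})$, and, for $d=3$, $G_\zeta$ consists of all vectors $p(\mathbf{f}_{i,j,k+1}-\mathbf{f}_{i,j,k})$. *)

(* Defs.v *)
From HB Require Import structures.
From mathcomp Require Import all_boot all_order all_algebra.
From mathcomp Require Import all_classical all_reals all_analysis.

Set Implicit Arguments.
Unset Strict Implicit.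
Unset Printing Implicit Defensive.

Import Order.TTheory GRing.Theory Num.Theory.
Import numFieldNormedType.Exports.

Local Open Scope classical_set_scope.
Local Open Scope ring_scope.

(* Points of R^d are row vectors; coordinates 0, 1, 2 are xi, eta, zeta. *)

Inductive domain_shape := Cube | Simplex.

Definition ref_domain (R : realType) (d : nat) (U : domain_shape) :
    set 'rV[R]_d :=
  match U with
  | Cube => [set x | forall i, 0 <= x 0 i <= 1]
  | Simplex => [set x | (forall i, 0 <= x 0 i) /\ \sum_i x 0 i <= 1]
  end.

(* A multi-index of the simplex has all its entries at most p, so both shapes
   share the same ambient type, cut down by [admissible]. *)
Definition multi_index (d p : nat) := {ffun 'I_d -> 'I_p.+1}.

Definition admissible (d p : nat) (U : domain_shape) (a : multi_index d p) :
    bool :=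
  match U with
  | Cube => true
  | Simplex => (\sum_i a i <= p)%N
  end.

Definition polynomial_on (R : realType) (d : nat) (U : domain_shape) (p : nat)
    (F : 'rV[R]_d -> 'rV[R]_d) : Prop :=
  exists c : multi_index d p -> 'rV[R]_d,
    forall x, ref_domain U x ->
      F x = \sum_(a | admissible U a) (\prod_i x 0 i ^+ a i) *: c a.

Definition bernstein (R : realType) (d : nat) (U : domain_shape) (p : nat)
    (a : multi_index d p) (x : 'rV[R]_d) : R :=
  match U with
  | Cube =>
      \prod_i ('C(p, a i)%:R * (1 - x 0 i) ^+ (p - a i) * x 0 i ^+ a i)
  | Simplex =>
      p`!%:R / ((\prod_i (a i)`!) * (p - \sum_i a i)`!)%:R
      * (\prod_i x 0 i ^+ a i) * (1 - \sum_i x 0 i) ^+ (p - \sum_i a i)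
  end.

(* The values of f at non-admissible multi-indices are irrelevant, here and in
   [derivative_control_points]. *)
Definition BB_control_points (R : realType) (d : nat) (U : domain_shape)
    (p : nat) (F : 'rV[R]_d -> 'rV[R]_d) (f : multi_index d p -> 'rV[R]_d) :
    Prop :=
  forall x, ref_domain U x ->
    F x = \sum_(a | admissible U a) bernstein U a x *: f a.

(* b = a + e_j *)
Definition succ_index (d p : nat) (j : 'I_d) (a b : multi_index d p) : bool :=
  [forall i, nat_of_ord (b i) == (a i + (i == j))%N].

Definition derivative_control_points (R : realType) (d : nat)
    (U : domain_shape) (p : nat) (f : multi_index d p -> 'rV[R]_d)
    (j : 'I_d) : seq 'rV[R]_d :=
  [seq p%:R *: (f ab.2 - f ab.1)
    | ab <- enum {: multi_index d p * multi_index d p}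
      & [&& admissible U ab.1, admissible U ab.2 & succ_index j ab.1 ab.2]].

Definition hull (R : realType) (V : lmodType R) (A : set V) : set V :=
  smallest (@convex_set R V) A.

(* iterated partial derivatives of h along the directions listed in s *)
Definition partials (R : realType) (d : nat) (s : seq 'I_d)
    (h : 'rV[R]_d -> 'rV[R]_d) : 'rV[R]_d -> 'rV[R]_d :=
  foldr (fun i g => 'D_(delta_mx 0 i) g) h s.

(* C^oo on the open set N *)
Definition smooth_open (R : realType) (d : nat) (N : set 'rV[R]_d)
    (h : 'rV[R]_d -> 'rV[R]_d) : Prop :=
  forall (s : seq 'I_d) (x : 'rV[R]_d), N x ->
    {for x, continuous (partials s h)} /\
    forall i, derivable (partials s h) x (delta_mx 0 i).

(* Smoothness on an arbitrary set A; depends only on the values of g on A. *)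
Definition smooth_on (R : realType) (d : nat) (A : set 'rV[R]_d)
    (g : 'rV[R]_d -> 'rV[R]_d) : Prop :=
  forall y, A y -> exists (N : set 'rV[R]_d) (h : 'rV[R]_d -> 'rV[R]_d),
    [/\ open N, N y, smooth_open N h & {in A `&` N, g =1 h}].

(* Main.v *)
(** A control net [g] is sampled by products of the affine operators
    [1 + sum_(i in S) x_i Delta_i] (de Casteljau steps): [p] steps with
    [S] = all directions for the simplex, [p] steps with [S = {i}] for every
    [i] for the cube.  Telescoping such a product between [x] and [y] gives
    [F x - F y = (x - y) A(x, y)], where the [j]-th row of the polynomial matrix
    [A(x, y)] is an average of affine combinations of the control points of the
    [j]-th partial derivative, with nonnegative coefficients when [x] and [y]
    are in the domain; it then lies in their convex hull.  So [A] is invertible there and [F] is injective.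

    Near a point [F x0], Banach's fixed point theorem inverts the polynomial
    extension of [F].  The identity above for [x = h (y + t e_i)] and
    [x' = h y] shows that the local inverse [h] satisfies
    [D_i h = e_i A(h, h)^-1], so that rational expressions in the coordinates
    of [h] are stable under differentiation and [h] is smooth.  Compactness of
    the domain bounds [|x - x0|] by a multiple of [|F x - F x0|], so that the
    global inverse agrees with [h] near [F x0]. *)

Require Import Defs.
From HB Require Import structures.
From mathcomp Require Import all_boot all_order all_algebra.
From mathcomp Require Import all_classical all_reals all_analysis.
From mathcomp Require Import ring lra.

Set Implicit Arguments.
Unset Strict Implicit.
Unset Printing Implicit Defensive.

Import Order.TTheory GRing.Theory Num.Theory.
Import numFieldNormedType.Exports.

Local Open Scope classical_set_scope.
Local Open Scope ring_scope.

(** * Control nets and de Casteljau steps *)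

Section Nets.
Context (R : realType) (d : nat) (V : lmodType R).
Implicit Types (S : {set 'I_d}) (s : seq {set 'I_d}) (x y : 'rV[R]_d).
Implicit Types (a b : 'I_d -> nat) (g : ('I_d -> nat) -> V) (i j : 'I_d).

(** Indices are arbitrary functions to [nat], with no bound [p], so that shifts and differences are
    total. *)
Definition raise j b : 'I_d -> nat := fun k => (b k + (k == j))%N.

Definition lower j b : 'I_d -> nat := fun k => (b k - (k == j))%N.

Definition addix a b : 'I_d -> nat := fun k => (a k + b k)%N.

Definition fdiff j g b : V := g (raise j b) - g b.

Definition casteljau S x g b : V := g b + \sum_(i in S) x 0 i *: fdiff i g b.

Definition blossom s x g : ('I_d -> nat) -> V :=
  foldr (fun S => casteljau S x) g s.

(** The two summands come from telescoping: first the outermost step moves from [y] to [x] while the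
    inner ones are at [x], then the outermost step at [y] acts on the difference of the inner
    ones. *)
Fixpoint divdiff s x y j g b : V :=
  if s is T :: s' then
    (j \in T)%:R *: blossom s' x (fdiff j g) b
    + casteljau T y (divdiff s' x y j g) b
  else 0.

Lemma raiseC i j b : raise i (raise j b) = raise j (raise i b).
Proof. by apply/funext => k; rewrite /raise addnAC. Qed.

Lemma addix_raise j a b : addix (raise j a) b = addix a (raise j b).
Proof. by apply/funext => k; rewrite /addix /raise -addnA (addnC (b k)). Qed.

Lemma fdiff_casteljau j S x g :
  fdiff j (casteljau S x g) = casteljau S x (fdiff j g).
Proof.
apply/funext => b; rewrite /fdiff /casteljau opprD addrACA -sumrB.
congr (_ + _); apply: eq_bigr => i _.
by rewrite -scalerBr /fdiff raiseC !opprD addrACA.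
Qed.

Lemma fdiff_blossom j s x g : fdiff j (blossom s x g) = blossom s x (fdiff j g).
Proof. by elim: s => //= S s <-; rewrite fdiff_casteljau. Qed.

Lemma casteljau_lin (I : finType) (c : I -> R)
    (g : I -> ('I_d -> nat) -> V) S x b :
  casteljau S x (fun b' => \sum_k c k *: g k b') b
  = \sum_k c k *: casteljau S x (g k) b.
Proof.
rewrite /casteljau.
under [in RHS]eq_bigr do rewrite scalerDr scaler_sumr.
rewrite big_split /= exchange_big /=; congr (_ + _); apply: eq_bigr => i _.
rewrite /fdiff -sumrB scaler_sumr; apply: eq_bigr => k _.
by rewrite -scalerBr !scalerA mulrC.
Qed.

Lemma casteljauB x g1 g2 S b :
  casteljau S x (fun b' => g1 b' - g2 b') b
  = casteljau S x g1 b - casteljau S x g2 b.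
Proof.
rewrite /casteljau opprD addrACA -sumrB; congr (_ + _).
by apply: eq_bigr => i _; rewrite -scalerBr /fdiff !opprD addrACA.
Qed.

Lemma blossomB s x y g b :
  blossom s x g b - blossom s y g b
  = \sum_j (x 0 j - y 0 j) *: divdiff s x y j g b.
Proof.
elim: s b => [|S s IH] b /=.
  by rewrite subrr big1 // => j _; rewrite scaler0.
under eq_bigr do rewrite scalerDr.
rewrite big_split /= -casteljau_lin.
(* By induction the outer step at [y] acts on a difference of inner blossoms; what remains is the
   change of the outer step alone. *)
have -> : (fun b' => \sum_j (x 0 j - y 0 j) *: divdiff s x y j g b')
    = fun b' => blossom s x g b' - blossom s y g b'.
  by apply/funext => b'; rewrite IH.
rewrite casteljauB addrA; congr (_ - _).
rewrite [in RHS]/casteljau addrCA; congr (_ + _).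
rewrite [in LHS]big_mkcond [X in _ = _ + X]big_mkcond -big_split /=.
apply: eq_bigr => i _; rewrite fdiff_blossom; case: ifP => _.
  by rewrite scale1r -scalerDl subrK.
by rewrite scale0r scaler0 addr0.
Qed.

End Nets.

(** * Convex combinations *)

Section Convexity.
Context (R : realType) (V : lmodType R).
Implicit Types (C : set V) (u v : V).

Lemma convex_comb2 C u v (t : R) : @convex_set R V C -> 0 <= t <= 1 ->
  C u -> C v -> C (t *: u + (1 - t) *: v).
Proof.
move=> cC /andP[t0 t1] Cu Cv.
have t01 : Itv.spec (@Itv.num_sem R) (Itv.Real `[0%Z, 1%Z]) t.
  by apply/and3P; split; rewrite ?num_real // bnd_simp.
have := cC u v (Itv.mk t01).
by rewrite !inE => /(_ Cu Cv).
Qed.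

(** The point [u] carries the leftover weight. Induction splits off [v i] and rescales the other
    weights by the inverse of [1 - w i]. *)
Lemma convex_comb_from C (I : Type) (r : seq I) (P : pred I) u
    (v : I -> V) (w : I -> R) :
  @convex_set R V C -> C u -> (forall i, P i -> C (v i)) ->
  (forall i, P i -> 0 <= w i) -> \sum_(i <- r | P i) w i <= 1 ->
  C (u + \sum_(i <- r | P i) w i *: (v i - u)).
Proof.
move=> cC Cu Cv; elim: r w => [|i r IH] w w0; first by rewrite !big_nil addr0.
rewrite !big_cons; case: ifP => [Pi|_]; last exact: IH.
move=> w1; have r0 : 0 <= \sum_(k <- r | P k) w k by exact: sumr_ge0.
(* If [w i] is 1 the rescaling would divide by zero, but then all other weights vanish. *)
have [wi1|wi1] := eqVneq (w i) 1.
  have rest0 : \sum_(k <- r | P k) w k = 0.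
    by apply/eqP; rewrite eq_le r0 andbT -(lerD2l (w i)) addr0 wi1 -{1}wi1.
  have -> : \sum_(k <- r | P k) w k *: (v k - u) = 0.
    move: rest0; elim: (r) => [|k q IHq]; first by rewrite !big_nil.
    rewrite !big_cons; case: ifP => [Pk|_] //.
    move=> /eqP; rewrite paddr_eq0 ?w0 ?sumr_ge0 // => /andP[/eqP -> /eqP q0].
    by rewrite scale0r add0r IHq.
  by rewrite wi1 scale1r addr0 addrC subrK; exact: Cv.
have lt1 : 0 < 1 - w i.
  rewrite subr_gt0 lt_neqAle wi1 /=; apply: le_trans w1.
  by rewrite lerDl.
have -> : u + (w i *: (v i - u) + \sum_(k <- r | P k) w k *: (v k - u))
   = w i *: v i + (1 - w i) *:
      (u + \sum_(k <- r | P k) (w k / (1 - w i)) *: (v k - u)).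
  rewrite [in RHS]scalerDr scaler_sumr.
  under [in RHS]eq_bigr do rewrite scalerA mulrC divfK ?gt_eqF //.
  by rewrite !addrA; congr (_ + _); rewrite scalerBr scalerBl scale1r addrCA.
apply: convex_comb2 => //.
- by rewrite w0 // -subr_ge0 ltW.
- exact: Cv.
- apply: IH => [k Pk|]; first by rewrite divr_ge0 ?w0 // ltW.
  by rewrite -mulr_suml ler_pdivrMr // mul1r lerBrDl.
Qed.

(** For convex nonempty [C] this is the set of sums of [n] elements of [C]; scaling up instead of
    averaging allows [n = 0]. *)
Definition dilate (n : nat) C : set V := [set v | exists2 c, C c & v = n%:R *: c].

Lemma convex_dilate n C : @convex_set R V C -> @convex_set R V (dilate n C).
Proof.
move=> cC u v t; rewrite !inE => -[c Cc ->] [e Ce ->].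
exists (t%:num *: c + (1 - t%:num) *: e); last first.
  by rewrite scalerDr !scalerA ![n%:R * _]mulrC -!scalerA.
by have := cC c e t; rewrite !inE => /(_ Cc Ce).
Qed.

Lemma dilateS n C u v : @convex_set R V C -> C u -> dilate n C v ->
  dilate n.+1 C (u + v).
Proof.
move=> cC Cu [c Cc ->].
exists (n.+1%:R^-1 *: u + (1 - n.+1%:R^-1) *: c).
  apply: convex_comb2 => //; rewrite invr_ge0 ler0n /=.
  by rewrite invf_le1 ?ltr0n // ler1n.
rewrite scalerDr !scalerA mulrBr mulr1 mulfV ?pnatr_eq0 // scale1r.
by rewrite -natr1 addrK.
Qed.

Lemma sub_hull (C : set V) : C `<=` hull C.
Proof. exact: sub_smallest. Qed.

Lemma convex_hull (C : set V) : @convex_set R V (hull C).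
Proof.
move=> u v t; rewrite !inE => hu hv D [cD CD].
have := cD u v t; rewrite !inE; apply; first exact: hu.
exact: hv.
Qed.

End Convexity.
Arguments dilate {R V}.

(** * Sampled indices, and convexity of blossoms and divided differences *)

Section Reach.
Context (R : realType) (d : nat) (V : lmodType R).
Implicit Types (S : {set 'I_d}) (s : seq {set 'I_d}) (x y : 'rV[R]_d).
Implicit Types (a b : 'I_d -> nat) (g : ('I_d -> nat) -> V) (i j : 'I_d).
Implicit Type C : set V.

Definition mult s i := count (fun S => i \in S) s.

(* A superset of the offsets at which [blossom s x g] samples [g]; it is exact
   for the two sequences of interest. *)
Definition reach s b :=
  [forall i, (b i <= mult s i)%N] && (\sum_i b i <= size s)%N.

(** Under this condition each step of [s] at [x] is a convex combination. *)
Definition sub_unit s x :=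
  (forall i, 0 <= x 0 i) /\ forall S, S \in s -> \sum_(i in S) x 0 i <= 1.

Lemma sub_unit_cons S s x : sub_unit (S :: s) x -> sub_unit s x.
Proof. by move=> [x0 xS]; split=> // T Ts; apply: xS; rewrite inE Ts orbT. Qed.

Lemma reach0 s : reach s (fun=> 0%N).
Proof. by apply/andP; split; [apply/forallP | rewrite big1]. Qed.

Lemma reach_cons S s b : reach s b -> reach (S :: s) b.
Proof.
move=> /andP[/forallP bm bs]; apply/andP; split; last exact: leqW.
by apply/forallP => i; rewrite (leq_trans (bm i)) // leq_addl.
Qed.

Lemma reach_raise S s i b : i \in S -> reach s b -> reach (S :: s) (raise i b).
Proof.
move=> iS /andP[/forallP bm bs]; apply/andP; split.
  apply/forallP => k; rewrite /mult /= addnC leq_add //.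
  by case: eqP => [->|//]; rewrite iS.
rewrite /raise big_split /= addnC (bigD1 i) //= eqxx big1 ?addn0 //.
by move=> k /negPf ->.
Qed.

Lemma casteljau_convex C S x g b : @convex_set R V C ->
  (forall i, 0 <= x 0 i) -> \sum_(i in S) x 0 i <= 1 ->
  C (g b) -> (forall i, i \in S -> C (g (raise i b))) -> C (casteljau S x g b).
Proof. by move=> cC x0 x1 Cb CS; apply: convex_comb_from. Qed.

Lemma blossom_convex C s x g a : @convex_set R V C -> sub_unit s x ->
  (forall b, reach s b -> C (g (addix a b))) -> C (blossom s x g a).
Proof.
move=> cC; elim: s a => [|S s IH] a sx Cg /=.
  have -> : a = addix a (fun=> 0%N) by apply/funext => k; rewrite /addix addn0.
  by apply: Cg; exact: reach0.
have sx' := sub_unit_cons sx; apply: casteljau_convex => //.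
- by case: sx.
- by case: sx => _; apply; rewrite mem_head.
- by apply: IH => // b /(reach_cons S); exact: Cg.
- move=> i iS; apply: IH => // b rb; rewrite addix_raise.
  by apply: Cg; exact: reach_raise.
Qed.

(** Each step containing [j] adds one blossom of differences, a point of [C], and every step
    averages the sum collected so far. Differences are taken only where both control points are
    reachable. *)
Lemma divdiff_convex C s x y j g a :
  @convex_set R V C -> C !=set0 -> sub_unit s x -> sub_unit s y ->
  (forall b, reach s b -> reach s (raise j b) -> C (fdiff j g (addix a b))) ->
  dilate (mult s j) C (divdiff s x y j g a).
Proof.
move=> cC [c0 Cc0]; elim: s a => [|S s IH] a sx sy Cg /=.
  by exists c0; rewrite ?scale0r.
have sx' := sub_unit_cons sx; have sy' := sub_unit_cons sy.
have step : dilate (mult s j) C (casteljau S y (divdiff s x y j g) a).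
  apply: casteljau_convex; first exact: convex_dilate.
  - by case: sy.
  - by case: sy => _; apply; rewrite mem_head.
  - by apply: IH => // b rb rjb; apply: Cg; exact: reach_cons.
  - move=> i iS; apply: IH => // b rb rjb; rewrite addix_raise.
    by apply: Cg; rewrite 1?raiseC; exact: reach_raise.
rewrite /mult /=; case: (boolP (j \in S)) => jS; last by rewrite scale0r add0r.
rewrite scale1r; apply: dilateS => //.
apply: blossom_convex => // b rb.
by apply: Cg; [exact: reach_cons | exact: reach_raise].
Qed.

End Reach.

(** * Bernstein weights *)

Section Weights.
Context (R : realType) (d : nat) (V : lmodType R).
Implicit Types (S : {set 'I_d}) (s : seq {set 'I_d}) (x : 'rV[R]_d).
Implicit Types (a b : 'I_d -> nat) (g : ('I_d -> nat) -> V) (i j : 'I_d).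

Definition ix p (b : multi_index d p) : 'I_d -> nat := fun k => b k.

Lemma raiseK i : cancel (@raise d i) (lower i).
Proof. by move=> b; apply/funext => k; rewrite /lower /raise addnK. Qed.

Lemma sum_raise p (W : ('I_d -> nat) -> R) g a i :
  (forall b, (p <= b i)%N -> W b = 0) ->
  \sum_(b : multi_index d p) W (ix b) *: g (addix a (raise i (ix b)))
  = \sum_(b : multi_index d p)
      (if (0 < b i)%N then W (lower i (ix b)) else 0) *: g (addix a (ix b)).
Proof.
move=> W0.
(* The cyclic successor in coordinate [i] permutes the whole index type; at the wrap-around from [p]
   to 0 both sides contribute zero. *)
pose h (b : multi_index d p) : multi_index d p :=
  [ffun k => if k == i then ordS (b k) else b k].
have h_inj : injective h.
  move=> b c /ffunP bc; apply/ffunP => k; have := bc k; rewrite !ffunE.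
  by case: ifP => // _; exact: ordS_inj.
rewrite [RHS](reindex_inj h_inj); apply: eq_bigr => b _.
have [bp|pb] := ltnP (b i) p; last first.
  rewrite W0 // scale0r ffunE eqxx /=.
  have -> : nat_of_ord (b i) = p by apply/anti_leq; rewrite pb -ltnS ltn_ord.
  by rewrite modnn /= scale0r.
have E : ix (h b) = raise i (ix b).
  apply/funext => k; rewrite /ix ffunE /raise.
  case: eqP => [->|_]; last by rewrite addn0.
  by rewrite /= modn_small // addn1.
by rewrite -/(ix (h b) i) E raiseK /raise eqxx addn1.
Qed.

(* [W s b] is the coefficient of [g (a + b)] in [blossom s x g a]. *)
Lemma blossomE p (Q : pred {set 'I_d}) x
    (W : seq {set 'I_d} -> ('I_d -> nat) -> R) s g a :
  (forall s b i, all Q s -> (mult s i < b i)%N -> W s b = 0) ->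
  W [::] (fun=> 0%N) = 1 ->
  (forall S s b, Q S -> all Q s ->
     W (S :: s) b = (1 - \sum_(i in S) x 0 i) * W s b
     + \sum_(i in S) x 0 i * (if (0 < b i)%N then W s (lower i b) else 0)) ->
  all Q s -> (forall i, (mult s i <= p)%N) ->
  blossom s x g a = \sum_(b : multi_index d p) W s (ix b) *: g (addix a (ix b)).
Proof.
move=> Wsupp W0 WS; elim: s a => [|S s IH] a /=.
  move=> _ _; rewrite (bigD1 [ffun=> ord0]) //= big1 ?addr0.
    have -> : ix ([ffun=> ord0] : multi_index d p) = (fun=> 0%N).
      by apply/funext => k; rewrite /ix ffunE.
    by rewrite W0 scale1r; congr g; apply/funext => k; rewrite /addix addn0.
  move=> b b0; have [k bk] : exists k, b k != ord0.
    apply/existsP; apply: contraNT b0 => /existsPn b0.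
    by apply/eqP/ffunP => k; rewrite ffunE; have := b0 k; rewrite negbK => /eqP.
  by rewrite (Wsupp _ _ k) ?scale0r //= lt0n.
move=> /andP[QS Qs] mp.
have {}IH a' := IH a' Qs (fun i => leq_trans (leq_addl _ _) (mp i)).
rewrite /casteljau /fdiff.
under eq_bigr do rewrite !IH -sumrB scaler_sumr.
rewrite IH exchange_big -big_split /=.
under eq_bigr => b _.
  under eq_bigr => i iS do rewrite addix_raise -scalerBr scalerA scalerBr.
  rewrite sumrB -scaler_suml addrCA -scalerBl -mulr_suml.
  rewrite -[X in X - _]mul1r -mulrBl.
  over.
rewrite big_split /= addrC exchange_big /=.
under [in RHS]eq_bigr do rewrite WS // scalerDl scaler_suml.
rewrite big_split /=; congr (_ + _).
rewrite [RHS]exchange_big /=; apply: eq_bigr => i iS.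
under eq_bigr do rewrite -scalerA.
under [RHS]eq_bigr do rewrite -scalerA.
(* As [i] is in [S], the tail [s] has fewer than [p] steps through [i], so its weights vanish once
   [b i] reaches [p]. *)
rewrite -!scaler_sumr; congr (_ *: _); apply: sum_raise => b pb.
apply: (Wsupp _ _ i) => //; apply: leq_trans pb.
by apply: leq_trans (mp i); rewrite /mult /= iS.
Qed.

End Weights.

(** * Closed forms and recurrences of the weights for the cube and the simplex *)

Section ClosedForms.
Context (R : realType) (d : nat).
Implicit Types (s : seq {set 'I_d}) (x : 'rV[R]_d) (b : 'I_d -> nat) (i : 'I_d).

Definition bern (n k : nat) (t : R) := 'C(n, k)%:R * (1 - t) ^+ (n - k) * t ^+ k.

Lemma bern_small n k t : (n < k)%N -> bern n k t = 0.
Proof. by move=> nk; rewrite /bern bin_small // mulr0n !mul0r. Qed.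

Lemma bernS n k t : bern n.+1 k t
  = (1 - t) * bern n k t + t * (if (0 < k)%N then bern n k.-1 t else 0).
Proof.
rewrite /bern; case: k => [|k] /=.
  by rewrite mulr0 addr0 !bin0 !subn0 exprS; ring.
rewrite binS natrD !mulrDl subSS; congr (_ + _); last by rewrite (exprS t); ring.
(* Pascal's rule has split off one term; in the other the subtraction truncates for [k >= n], where
   the binomial coefficient is zero. *)
have [kn|nk] := ltnP k n; last by rewrite bin_small // !mul0r !mulr0 addr0.
by rewrite -[in LHS](subnSK kn) exprS; ring.
Qed.

Definition cube_weight x s b := \prod_i bern (mult s i) (b i) (x 0 i).

Lemma cube_weight_set1 x j s b :
  cube_weight x ([set j]%SET :: s) b = (1 - x 0 j) * cube_weight x s b
  + x 0 j * (if (0 < b j)%N then cube_weight x s (lower j b) else 0).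
Proof.
rewrite /cube_weight !(bigD1 (P := predT) j) //=.
have E : forall c : 'I_d -> nat, (forall i, i != j -> c i = b i) ->
   \prod_(i < d | i != j) bern (mult s i) (c i) (x 0 i) =
   \prod_(i < d | i != j) bern (mult s i) (b i) (x 0 i).
  by move=> c cb; apply: eq_bigr => i /cb ->.
have -> : \prod_(i < d | i != j) bern (mult ([set j]%SET :: s) i) (b i) (x 0 i) =
    \prod_(i < d | i != j) bern (mult s i) (b i) (x 0 i).
  by apply: eq_bigr => i ij; rewrite /mult /= inE (negPf ij).
rewrite [in X in _ + X]E; last by move=> i /negPf ij; rewrite /lower ij subn0.
rewrite inE eqxx add1n.
rewrite bernS /lower eqxx subn1; case: ifP => _; ring.
Qed.

(** A divided power of the last barycentric coordinate. Without the guard, truncated subtraction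
    would give 1 instead of 0 for [n > q]. *)
Definition simplex_rest (l : R) q n : R :=
  if (n <= q)%N then l ^+ (q - n) / (q - n)`!%:R else 0.

Lemma simplex_restS l q n : l * simplex_rest l q n
  = (q.+1%:R - n%:R) * simplex_rest l q.+1 n.
Proof.
rewrite /simplex_rest; have [nq|qn] := leqP n q.
  rewrite leqW // -natrB ?(leqW nq) // subSn // exprS factS natrM invfM.
  have f0 : (q - n)`!%:R != 0 :> R by rewrite pnatr_eq0 -lt0n fact_gt0.
  have g0 : (q - n).+1%:R != 0 :> R by rewrite pnatr_eq0.
  by field; rewrite f0 nat1r g0.
rewrite mulr0; case: ifP => [nq|_]; last by rewrite mulr0.
suff -> : n = q.+1 by rewrite subrr mul0r.
by apply/anti_leq; rewrite nq qn.
Qed.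

Definition simplex_weight x s b : R :=
  (size s)`!%:R * \prod_i (x 0 i ^+ b i / (b i)`!%:R)
  * simplex_rest (1 - \sum_i x 0 i) (size s) (\sum_i b i)%N.

Lemma sum_lower b j : (0 < b j)%N ->
  (\sum_i b i)%N = (\sum_i lower j b i).+1.
Proof.
move=> bj; rewrite (bigD1 j) //= [in RHS](bigD1 j) //= /lower eqxx subn1.
rewrite -addSn prednK //; congr addn; apply: eq_bigr => i /negPf ->.
by rewrite subn0.
Qed.

(** Lowering [b i] in a divided power and multiplying by [x 0 i] produces the factor [b i], so the
    sum contributes [n], the sum of the [b i]. By [simplex_restS] the first term contributes
    [q + 1 - n]. The total [q + 1] turns the factorial of [q] into that of [q + 1]. *)
Lemma simplex_weight_setT x s b :
  simplex_weight x ([set: 'I_d]%SET :: s) b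
  = (1 - \sum_i x 0 i) * simplex_weight x s b
    + \sum_i x 0 i * (if (0 < b i)%N then simplex_weight x s (lower i b) else 0).
Proof.
rewrite /simplex_weight /=; set l := 1 - _; set q := size s.
set P := \prod_(_ < _) _; set n := (\sum_i b i)%N.
have -> : \sum_i x 0 i * (if (0 < b i)%N then q`!%:R *
      \prod_k (x 0 k ^+ lower i b k / (lower i b k)`!%:R) *
      simplex_rest l q (\sum_k lower i b k)%N else 0)
    = q`!%:R * P * simplex_rest l q.+1 n * n%:R.
  rewrite natr_sum mulr_sumr; apply: eq_bigr => i _.
  case: ifP => [bi|/negbT]; last by rewrite -eqn0Ngt => /eqP ->; rewrite !mulr0.
  rewrite {2}/simplex_rest /n (sum_lower bi) ltnS subSS -/(simplex_rest _ _ _).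
  rewrite /P !(bigD1 (P := predT) i) //= {1 2}/lower eqxx subn1.
  have -> : \prod_(k < d | k != i) (x 0 k ^+ lower i b k / (lower i b k)`!%:R) =
      \prod_(k < d | k != i) (x 0 k ^+ b k / (b k)`!%:R).
    by apply: eq_bigr => k /negPf ki; rewrite /lower ki subn0.
  case: (b i) bi => // m _; rewrite exprS factS natrM invfM /=.
  have g0 : m.+1%:R != 0 :> R by rewrite pnatr_eq0.
  set Q := \prod_(_ < _ | _) _; set r := simplex_rest _ _ _.
  rewrite -[LHS](mulfK g0); ring.
rewrite mulrCA simplex_restS factS natrM; ring.
Qed.

End ClosedForms.

(** * Bernstein-Bézier forms as blossoms of control nets *)

Section BernsteinBezier.
Context (R : realType) (d : nat).
Implicit Types (x y : 'rV[R]_d) (b : 'I_d -> nat) (i j : 'I_d).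

Definition steps (U : domain_shape) p : seq {set 'I_d} :=
  match U with
  | Cube => [seq [set i]%SET | i <- flatten (nseq p (enum 'I_d))]
  | Simplex => nseq p [set: 'I_d]%SET
  end.

(** Entries above [p] are sent to 0 by [inord]; the indices in [reach] never have such entries. *)
Definition net p (f : multi_index d p -> 'rV[R]_d) b : 'rV[R]_d :=
  f [ffun i => inord (b i)].

Lemma mult_steps U p i : mult (steps U p) i = p.
Proof.
rewrite /mult; case: U => /=; last by rewrite count_nseq inE mul1n.
rewrite count_map count_flatten map_nseq sumn_nseq -[RHS]mul1n; congr muln.
rewrite (eq_count (a2 := pred1 i)) => [|k /=]; last by rewrite inE eq_sym.
by rewrite count_uniq_mem ?enum_uniq // mem_enum.
Qed.

Lemma reach_admissible U p (a : multi_index d p) :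
  reach (steps U p) (ix a) -> admissible U a.
Proof. by case: U => //= /andP[_]; rewrite size_nseq. Qed.

Lemma reach_raise0 (s : seq {set 'I_d}) j :
  (0 < mult s j)%N -> reach s (raise j (fun=> 0%N)).
Proof.
move=> sj; apply/andP; split.
  by apply/forallP => i; rewrite /raise add0n; case: eqP => // ->.
rewrite (bigD1 j) //= big1 => [|i /negPf ij]; last by rewrite /raise ij.
by rewrite /raise eqxx !addn0; apply: leq_trans sj (count_size _ _).
Qed.

Lemma sub_unit_steps U p x : ref_domain U x -> sub_unit (steps U p) x.
Proof.
case: U => /= [x01|[x0 x1]]; split=> //.
- by move=> i; have /andP[] := x01 i.
- by move=> S /mapP[i _ ->]; rewrite big_set1; have /andP[] := x01 i.
- by move=> S /nseqP[-> _]; rewrite big_mkcond; under eq_bigr do rewrite inE.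
Qed.

Lemma net_ix p (f : multi_index d p -> 'rV[R]_d) (a : multi_index d p) :
  net f (ix a) = f a.
Proof. by congr f; apply/ffunP => i; rewrite ffunE inord_val. Qed.

Lemma addix0 b : addix (fun=> 0%N) b = b.
Proof. by apply/funext => k; rewrite /addix add0n. Qed.

Lemma ix_inord p b : (forall i, (b i <= p)%N) ->
  b = ix ([ffun i => inord (b i)] : multi_index d p).
Proof. by move=> bp; apply/funext => i; rewrite /ix ffunE inordK ?ltnS. Qed.

Lemma blossom_steps U p (f : multi_index d p -> 'rV[R]_d) x :
  blossom (steps U p) x (net f) (fun=> 0%N)
  = \sum_(a | admissible U a) bernstein U a x *: f a.
Proof.
have mp i : (mult (steps U p) i <= p)%N by rewrite mult_steps.
case: U mp => mp.
(* [Q] selects the kind of step for which the closed form of the weights satisfies the recurrence: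
   singletons here, the full set for the simplex. *)
- pose Q (S : {set 'I_d}) := [exists i, S == [set i]%SET].
  rewrite (@blossomE _ _ _ p Q x (cube_weight x)) //.
  + apply: eq_bigr => a _; rewrite addix0 net_ix; congr (_ *: _).
    by apply: eq_bigr => i _; rewrite (mult_steps Cube).
  + by move=> s b i _ sb; rewrite /cube_weight (bigD1 i) //= bern_small ?mul0r.
  + by rewrite /cube_weight big1 // => i _; rewrite /bern bin0 !expr0 !mulr1.
  + by move=> S s b /existsP[i /eqP ->] _; rewrite cube_weight_set1 !big_set1.
  + by apply/allP => S /mapP[i _ ->]; apply/existsP; exists i.
- pose Q (S : {set 'I_d}) := S == [set: 'I_d]%SET.
  have sumT S (F : 'I_d -> R) : Q S -> \sum_(i in S) F i = \sum_i F i.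
    by move=> /eqP ->; rewrite big_mkcond; under eq_bigr do rewrite inE.
  have multQ s i : all Q s -> mult s i = size s.
    move=> /allP Qs; apply/eqP; rewrite -all_count.
    by apply/allP => S /Qs /eqP ->; rewrite inE.
  rewrite (@blossomE _ _ _ p Q x (simplex_weight x)) //.
  + rewrite [RHS]big_mkcond; apply: eq_bigr => a _; rewrite addix0 net_ix.
    rewrite /simplex_weight /simplex_rest size_nseq /= /ix.
    case: ifP => [ap|_]; last by rewrite mulr0 scale0r.
    congr (_ *: _); rewrite prodf_div natrM natr_prod invfM; ring.
  + move=> s b i Qs; rewrite multQ // => sb.
    rewrite /simplex_weight /simplex_rest leqNgt (leq_trans sb) ?mulr0 //.
    by rewrite (bigD1 i) //= leq_addr.
  + rewrite /simplex_weight /simplex_rest.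
    have -> : (\sum_(i < d) 0)%N = 0%N by rewrite big1.
    by rewrite /= subnn expr0 !divr1 mulr1 mul1r big1.
  + move=> S s b QS _; rewrite !sumT //; move/eqP: QS => ->.
    exact: simplex_weight_setT.
  + by apply/allP => S /nseqP[-> _]; exact: eqxx.
Qed.

Lemma hull_divdiff U p (f : multi_index d p -> 'rV[R]_d) x y j : (0 < p)%N ->
  ref_domain U x -> ref_domain U y ->
  hull [set` derivative_control_points U f j]
    (divdiff (steps U p) x y j (net f) (fun=> 0%N)).
Proof.
move=> p0 Ux Uy; set H := hull _.
(* [C] is the hull shrunk by [p], which holds the plain differences. Direction [j] occurs in [p]
   steps, so the divided difference is [p] times a point of [C]. *)
pose C : set 'rV[R]_d := [set v | H (p%:R *: v)].
have cC : convex_set C.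
  move=> u v t; rewrite !inE => Cu Cv.
  have := @convex_hull _ _ [set` derivative_control_points U f j]
    (p%:R *: u) (p%:R *: v) t.
  rewrite !inE => /(_ Cu Cv).
  have E (v1 v2 : 'rV[R]_d) (r : R) : r *: (p%:R *: v1) + (1 - r) *: (p%:R *: v2)
      = p%:R *: (r *: v1 + (1 - r) *: v2).
    by rewrite scalerDr !scalerA ![p%:R * _]mulrC.
  by move=> Huv; rewrite /C /= -[X in H X]E; exact: Huv.
have Cdiff b : reach (steps U p) b -> reach (steps U p) (raise j b) ->
    C (fdiff j (net f) (addix (fun=> 0%N) b)).
  move=> rb rjb; rewrite addix0 /fdiff; apply: sub_hull => /=.
  have bp i : (b i <= p)%N.
    by have /andP[/forallP/(_ i)] := rb; rewrite mult_steps.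
  have jbp i : (raise j b i <= p)%N.
    by have /andP[/forallP/(_ i)] := rjb; rewrite mult_steps.
  move: rb rjb; rewrite (ix_inord jbp).
  have := ix_inord bp; set a := finfun _; set a' := finfun _ => ba.
  have aa' : succ_index j a a'.
    by apply/forallP => i; rewrite !ffunE !inordK ?ltnS.
  rewrite ba !net_ix => ra ra'.
  apply/mapP; exists (a, a') => //; rewrite mem_filter /= mem_enum inE andbT.
  by rewrite aa' !reach_admissible.
(* Since [p > 0], the zero index can be raised in direction [j]. *)
have /divdiff_convex : C !=set0.
  exists (fdiff j (net f) (addix (fun=> 0%N) (fun=> 0%N))).
  by apply: Cdiff; [exact: reach0 | apply: reach_raise0; rewrite mult_steps].
move=> /(_ _ (steps U p) x y j (net f) (fun=> 0%N) cC).
case=> //; try exact: sub_unit_steps.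
by rewrite mult_steps => c Cc ->.
Qed.

End BernsteinBezier.

(** * Algebras of functions and matrix norms *)

Section AlgebraOfFunctions.
Context (R : realType) (T : Type).
Implicit Types (K : (T -> R) -> Prop) (d : nat).

(** Lets one argument on polynomial expressions serve both continuity at a point and rationality in
    the coordinates of the local inverse. *)
Definition function_algebra K :=
  [/\ forall c, K (fun=> c),
      forall f g, K f -> K g -> K (fun t => f t + g t) &
      forall f g, K f -> K g -> K (fun t => f t * g t)].

Section Closure.
Context K (Kalg : function_algebra K).

Lemma algebra_cst c : K (fun=> c). Proof. by case: Kalg. Qed.

Lemma algebraD f g : K f -> K g -> K (fun t => f t + g t).
Proof. by case: Kalg => _ + _; apply. Qed.

Lemma algebraM f g : K f -> K g -> K (fun t => f t * g t).
Proof. by case: Kalg => _ _; apply. Qed.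

Lemma algebraB f g : K f -> K g -> K (fun t => f t - g t).
Proof.
move=> Kf Kg; have -> : (fun t => f t - g t) = (fun t => f t + (-1) * g t).
  by apply/funext => t; rewrite mulN1r.
by apply: algebraD Kf _; apply: algebraM Kg; exact: algebra_cst.
Qed.

Lemma algebra_sum (I : Type) (r : seq I) (Q : pred I) (f : I -> T -> R) :
  (forall i, Q i -> K (f i)) -> K (fun t => \sum_(i <- r | Q i) f i t).
Proof.
move=> Kf; elim: r => [|i r IH].
  by under eq_fun do rewrite big_nil; exact: algebra_cst.
case: (boolP (Q i)) => Qi.
  by under eq_fun do rewrite big_cons Qi; apply: algebraD IH; exact: Kf.
by under eq_fun do rewrite big_cons (negPf Qi).
Qed.

Lemma algebra_prod (I : Type) (r : seq I) (Q : pred I) (f : I -> T -> R) :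
  (forall i, Q i -> K (f i)) -> K (fun t => \prod_(i <- r | Q i) f i t).
Proof.
move=> Kf; elim: r => [|i r IH].
  by under eq_fun do rewrite big_nil; exact: algebra_cst.
case: (boolP (Q i)) => Qi.
  by under eq_fun do rewrite big_cons Qi; apply: algebraM IH; exact: Kf.
by under eq_fun do rewrite big_cons (negPf Qi).
Qed.

Lemma algebra_det d (M : T -> 'M[R]_d) :
  (forall i j, K (fun t => M t i j)) -> K (fun t => \det (M t)).
Proof.
move=> KM; apply: algebra_sum => s _; apply: algebraM; first exact: algebra_cst.
by apply: algebra_prod => i _; exact: KM.
Qed.

Lemma algebra_adj d (M : T -> 'M[R]_d) i j :
  (forall i j, K (fun t => M t i j)) -> K (fun t => (\adj (M t)) i j).
Proof.
move=> KM; under eq_fun do rewrite mxE.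
apply: algebraM; first exact: algebra_cst.
by apply: algebra_det => k l; under eq_fun do rewrite !mxE; exact: KM.
Qed.

Lemma algebra_mulmx m n p (M : T -> 'M[R]_(m, n)) (N : T -> 'M[R]_(n, p)) i j :
  (forall i j, K (fun t => M t i j)) -> (forall i j, K (fun t => N t i j)) ->
  K (fun t => (M t *m N t) i j).
Proof.
move=> KM KN; under eq_fun do rewrite mxE.
by apply: algebra_sum => k _; exact: algebraM.
Qed.

(** The adjugate formula replaces [invmx], whose case distinction on invertibility is not an algebra
    operation. *)
Lemma algebra_invmx d (M : T -> 'M[R]_d) i j :
  (forall i j, K (fun t => M t i j)) -> K (fun t => (\det (M t))^-1) ->
  K (fun t => ((\det (M t))^-1 *: \adj (M t)) i j).
Proof.
move=> KM Kdet; under eq_fun do rewrite mxE.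
by apply: algebraM => //; exact: algebra_adj.
Qed.

Lemma algebra_casteljau d (S : {set 'I_d}) (X : T -> 'rV[R]_d) m
    (g : T -> ('I_d -> nat) -> 'rV[R]_m) b k :
  (forall i, K (fun t => X t 0 i)) ->
  (forall b' k', K (fun t => g t b' 0 k')) ->
  K (fun t => casteljau S (X t) (g t) b 0 k).
Proof.
move=> KX Kg; under eq_fun do rewrite mxE summxE.
apply: algebraD; first exact: Kg.
apply: algebra_sum => i _; under eq_fun do rewrite 3!mxE.
by apply: algebraM => //; apply: algebraB.
Qed.

Lemma algebra_blossom d (s : seq {set 'I_d}) (X : T -> 'rV[R]_d) m
    (g : ('I_d -> nat) -> 'rV[R]_m) b k :
  (forall i, K (fun t => X t 0 i)) -> K (fun t => blossom s (X t) g b 0 k).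
Proof.
move=> KX; elim: s b k => [|S s IH] b k /=; first exact: algebra_cst.
exact: algebra_casteljau.
Qed.

Lemma algebra_divdiff d (s : seq {set 'I_d}) (X Y : T -> 'rV[R]_d) m j
    (g : ('I_d -> nat) -> 'rV[R]_m) b k :
  (forall i, K (fun t => X t 0 i)) -> (forall i, K (fun t => Y t 0 i)) ->
  K (fun t => divdiff s (X t) (Y t) j g b 0 k).
Proof.
move=> KX KY; elim: s b k => [|S s IH] b k /=.
  by under eq_fun do rewrite mxE; exact: algebra_cst.
under eq_fun do rewrite 2!mxE; apply: algebraD; last exact: algebra_casteljau.
by apply: algebraM; [exact: algebra_cst | exact: algebra_blossom].
Qed.

End Closure.
End AlgebraOfFunctions.

Lemma invmxE (R : realType) d (M : 'M[R]_d) :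
  M \in unitmx -> invmx M = (\det M)^-1 *: \adj M.
Proof. by rewrite /invmx => ->. Qed.

Section MatrixNorm.
Context (R : realType).

Lemma mx_entry_le m n (M : 'M[R]_(m, n)) i j : `|M i j| <= `|M|.
Proof.
rewrite [leRHS]/Num.Def.normr /= mx_normrE.
exact: (le_bigmax _ (fun ij : 'I_m * 'I_n => `|M ij.1 ij.2|) (i, j)).
Qed.

Lemma mx_norm_le m n (M : 'M[R]_(m, n)) (c : R) : 0 <= c ->
  (forall i j, `|M i j| <= c) -> `|M| <= c.
Proof.
move=> c0 Mc; rewrite /Num.Def.normr /= mx_normrE.
by apply: bigmax_le => // -[i j] _; exact: Mc.
Qed.

(** The norm is the largest absolute value of an entry, so a sum of [m] products costs a factor
    [m]. *)
Lemma mulmx_norm_le m n (v : 'rV[R]_m) (M : 'M[R]_(m, n)) :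
  `|v *m M| <= m%:R * `|M| * `|v|.
Proof.
apply: mx_norm_le => [|i j]; first by rewrite !mulr_ge0.
rewrite mxE (le_trans (ler_norm_sum _ _ _)) //.
rewrite -[m in m%:R]card_ord -mulrA mulr_natl -sumr_const ler_sum // => k _.
by rewrite normrM mulrC ler_pM // mx_entry_le.
Qed.

Lemma continuous_mx (T : topologicalType) m n (f : T -> 'M[R]_(m, n)) (t : T) :
  (forall i j, {for t, continuous (fun z => f z i j)}) ->
  {for t, continuous f}.
Proof.
move=> fc; apply/cvgrPdist_le => e e0; near=> z.
apply: mx_norm_le (ltW e0) _ => i j; rewrite !mxE.
move: i j; near: z; apply: filter_forall => i; apply: filter_forall => j.
by have /cvgrPdist_le := fc i j; apply.
Unshelve. all: by end_near. Qed.

Lemma continuous_algebra (T : topologicalType) (t : T) :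
  function_algebra (fun f : T -> R => {for t, continuous f}).
Proof.
split=> [c|f g cf cg|f g cf cg]; first exact: cst_continuous.
- exact: continuousD.
- exact: continuousM.
Qed.

Lemma continuous_entry m n (T : topologicalType) (t : T)
    (f : T -> 'M[R]_(m, n)) i j :
  {for t, continuous f} -> {for t, continuous (fun z => f z i j)}.
Proof.
move=> fc; apply: (@continuous_comp _ _ _ f (fun M => M i j)) => //.
exact: coord_continuous.
Qed.

End MatrixNorm.

(** * Local inversion *)

(** Row vectors become a complete normed space, as Banach's theorem requires. *)
HB.instance Definition _ (R : realType) (m n : nat) := Complete.on 'M[R]_(m, n).

Section LocalInverse.
Context (R : realType) (d : nat).
Variables (P : 'rV[R]_d -> 'rV[R]_d) (A : 'rV[R]_d -> 'rV[R]_d -> 'M[R]_d).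
Hypothesis PA : forall x y, P x - P y = (x - y) *m A x y.
Hypothesis A_algebra : forall (T : Type) (K : (T -> R) -> Prop)
    (X Y : T -> 'rV[R]_d),
  function_algebra K -> (forall i, K (fun t => X t 0 i)) ->
  (forall i, K (fun t => Y t 0 i)) -> forall i j, K (fun t => A (X t) (Y t) i j).
Variables (x0 : 'rV[R]_d).
Hypothesis A_unit : A x0 x0 \in unitmx.

Let B := invmx (A x0 x0).
Let E x y : 'M[R]_d := 1%:M - A x y *m B.

(** By [PA], [(x - y) *m E x y] is the increment of the map sending [x] to [x - P x *m B]. The bound
    makes this map a contraction of ratio 1/2, the factor [d] being the loss in [mulmx_norm_le]. It
    holds since [E] is continuous and vanishes at [(x0, x0)]. *)
Lemma defect_small : exists2 r : R, 0 < r &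
  forall x y : 'rV[R]_d,
    `|x - x0| <= r -> `|y - x0| <= r -> d%:R * `|E x y| <= 2^-1.
Proof.
pose D (z : 'rV[R]_d * 'rV[R]_d) : R := d%:R * `|E z.1 z.2|.
have cE : {for (x0, x0), continuous (fun z : 'rV[R]_d * 'rV[R]_d => E z.1 z.2)}.
  apply: continuous_mx => i j; have Kalg := @continuous_algebra R _ (x0, x0).
  have -> : (fun z => E z.1 z.2 i j)
      = (fun z => 1%:M i j - (A z.1 z.2 *m B) i j).
    by apply/funext => z; rewrite mxE [X in _ + X]mxE.
  apply: (algebraB Kalg); first exact: (algebra_cst Kalg).
  apply: (algebra_mulmx Kalg) => k l; last exact: (algebra_cst Kalg).
  apply: (A_algebra Kalg) => m.
    by apply: (@continuous_entry R 1 d _ (x0, x0) fst); exact: cvg_fst.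
  by apply: (@continuous_entry R 1 d _ (x0, x0) snd); exact: cvg_snd.
have E0 : E x0 x0 = 0 by rewrite /E mulmxV // subrr.
have d1 : 0 < d.+1%:R :> R by rewrite ltr0n.
have e0 : 0 < (2 * d.+1%:R)^-1 :> R by rewrite invr_gt0 mulr_gt0.
have /cvgrPdist_lt/(_ _ e0)/nbhs_ballP[r /= r0 rE] := cE.
(* The bounds on [x] and [y] are non-strict whereas the ball is open, hence the half. *)
exists (r / 2); first by rewrite divr_gt0.
move=> x y xr yr.
have /rE : ball (x0, x0) r (x, y).
  by split; rewrite -ball_normE /= distrC (le_lt_trans xr, le_lt_trans yr) //;
    rewrite ltr_pdivrMr // mulr_natr mulr2n ltrDl.
rewrite /= E0 sub0r normrN => /ltW Exy.
apply: (@le_trans _ _ (d.+1%:R * (2 * d.+1%:R)^-1)).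
  by rewrite ler_pM // ler_nat.
by rewrite invfM mulrCA mulfV ?mulr1 // gt_eqF.
Qed.

Lemma local_inverse : exists (r : R) (N : set 'rV[R]_d) (h : 'rV[R]_d -> 'rV[R]_d),
  [/\ 0 < r, open N, N (P x0),
      forall y, N y -> `|h y - x0| <= r /\ P (h y) = y &
      forall x y : 'rV[R]_d, `|x - x0| <= r -> `|y - x0| <= r ->
        A x y \in unitmx /\ `|x - y| <= 2 * `|(P x - P y) *m B|].
Proof.
have [r r0 rE] := defect_small; exists r.
have half (x y v : 'rV[R]_d) : `|x - x0| <= r -> `|y - x0| <= r ->
    `|v - v *m (A x y *m B)| <= 2^-1 * `|v|.
  move=> xr yr; rewrite -[v in v - _]mulmx1 -mulmxBr.
  by rewrite (le_trans (mulmx_norm_le v (E x y))) // ler_wpM2r // rE.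
pose N : set 'rV[R]_d := [set y | `|(y - P x0) *m B| < r / 2].
pose U : set 'rV[R]_d := [set x | `|x - x0| <= r].
have solve y : N y -> exists2 x, U x & P x = y.
  (* A Newton map with frozen derivative; its fixed points solve [P x = y]. It preserves the closed
     ball: contraction towards [x0] costs [r / 2], and so does the offset of [y] in [N]. *)
  move=> Ny; pose T x := x - (P x - y) *m B.
  have TU : set_fun U U T.
    move=> x Ux; rewrite /U /=.
    have -> : T x - x0 = ((x - x0) - (x - x0) *m (A x x0 *m B)) + (y - P x0) *m B.
      by rewrite mulmxA -PA /T !mulmxBl; apply/rowP => k; rewrite !mxE; ring.
    rewrite (le_trans (ler_normD _ _)) // (splitr r) lerD //; last exact: ltW.
    apply: (le_trans (half x x0 (x - x0) Ux _)).
      by rewrite subrr normr0 ltW.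
    by rewrite mulrC ler_wpM2r // invr_ge0.
  have q0 : 0 <= 2^-1 :> R by [].
  have [] := @banach_fixed_point R 'rV[R]_d U (mkfun_fun TU).
  - exists (NngNum q0); split => /=; first by rewrite invf_lt1 // ltr1n.
    move=> [x x'] /= [Ux Ux'].
    have -> : T x - T x' = (x - x') - (x - x') *m (A x x' *m B).
      by rewrite mulmxA -PA /T !mulmxBl; apply/rowP => k; rewrite !mxE; ring.
    exact: half.
  - have -> : U = closed_ball x0 r.
      rewrite closed_ballE //; apply/funext => x; apply/propext.
      by rewrite /U /closed_ball_ /= distrC.
    exact: closed_ball_closed.
  - by exists x0; rewrite /U /= subrr normr0 ltW.
  - move=> x Ux /= /eqP; rewrite -subr_eq0 opprB addrC subrK => /eqP xB.
    exists x => //; apply/eqP; rewrite -subr_eq0; apply/eqP.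
    have uB : B \in unitmx by rewrite unitmx_inv.
    by rewrite -[LHS](mulmxK uB) xB mul0mx.
pose h y := xget 0 [set x | U x /\ P x = y].
exists N, h; split=> //.
- have -> : N = (fun y => (y - P x0) *m B) @^-1` ball 0 (r / 2).
    by apply/funext => y; rewrite -ball_normE /N /= sub0r normrN.
  apply: open_comp; last exact: ball_open.
  move=> y _; apply: continuous_mx => i j.
  have Kalg := @continuous_algebra R _ y.
  apply: (algebra_mulmx Kalg) => k l; last exact: (algebra_cst Kalg).
  have -> : (fun t : 'rV[R]_d => (t - P x0) k l) = (fun t => t k l - P x0 k l).
    by apply/funext => t; rewrite !mxE.
  apply: (algebraB Kalg); last exact: (algebra_cst Kalg).
  exact: coord_continuous.
- by rewrite /N /= subrr mul0mx normr0 divr_gt0.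
- by move=> y /solve[x Ux Px]; rewrite /h; case: xgetP => [? _ []|/(_ x)[]].
move=> x y xr yr; split.
  (* A vector [v] killed by [A x y] satisfies |v| <= |v| / 2. *)
  rewrite -row_free_unit; apply/inj_row_free => v vA.
  have := half x y v xr yr; rewrite mulmxA vA mul0mx subr0.
  have := normr_ge0 v => v0 vh.
  by apply/eqP; rewrite -normr_eq0; apply/eqP; lra.
have := half x y (x - y) xr yr; rewrite mulmxA -PA => hxy.
have := ler_normD (x - y - (P x - P y) *m B) ((P x - P y) *m B).
rewrite subrK => tri; lra.
Qed.

End LocalInverse.

(** * Smoothness of the local inverse *)

Section SmoothInverse.
Context (R : realType) (d : nat).
Implicit Types (h : 'rV[R]_d -> 'rV[R]_d) (N : set 'rV[R]_d).

Local Notation e i := (delta_mx (0 : 'I_1) i : 'rV[R]_d).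

(* Rational expressions in the coordinates of [h] without poles on [N]. *)
Inductive rational_in N h : ('rV[R]_d -> R) -> Prop :=
| rational_cst c : rational_in N h (fun=> c)
| rational_coord i : rational_in N h (fun y => h y 0 i)
| rationalD f g : rational_in N h f -> rational_in N h g ->
    rational_in N h (fun y => f y + g y)
| rationalM f g : rational_in N h f -> rational_in N h g ->
    rational_in N h (fun y => f y * g y)
| rationalV f : rational_in N h f -> (forall y, N y -> f y != 0) ->
    rational_in N h (fun y => (f y)^-1).

Lemma rational_algebra N h : function_algebra (rational_in N h).
Proof. by split; [exact: rational_cst|exact: rationalD|exact: rationalM]. Qed.

Lemma rational_derive N h :
  (forall k i, exists2 g, rational_in N h g &
     forall y, N y -> is_derive y (e i) (fun z => h z 0 k) (g y)) ->
  forall f, rational_in N h f -> forall i, exists2 g, rational_in N h g &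
     forall y, N y -> is_derive y (e i) f (g y).
Proof.
move=> hD f; elim=> [c|k|f1 f2 K1 IH1 K2 IH2|f1 f2 K1 IH1 K2 IH2|f1 K1 IH1 f10] i.
- by exists (fun=> 0) => [|y _]; [exact: rational_cst | exact: is_derive_cst].
- exact: hD.
- have [g1 Kg1 D1] := IH1 i; have [g2 Kg2 D2] := IH2 i.
  exists (fun y => g1 y + g2 y) => [|y Ny]; first exact: rationalD.
  by have := D1 y Ny; have := D2 y Ny => ? ?; exact: is_deriveD.
- have [g1 Kg1 D1] := IH1 i; have [g2 Kg2 D2] := IH2 i.
  exists (fun y => f1 y * g2 y + f2 y * g1 y) => [|y Ny].
    by apply: rationalD; exact: rationalM.
  by have := D1 y Ny; have := D2 y Ny => ? ?; exact: is_deriveM.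
- have [g1 Kg1 D1] := IH1 i.
  exists (fun y => (-1) * ((f1 y)^-1 * (f1 y)^-1) * g1 y) => [|y Ny].
    apply: rationalM Kg1; apply: rationalM; first exact: rational_cst.
    by apply: rationalM; exact: rationalV.
  have [D1y <-] := D1 y Ny.
  have -> : -1 * ((f1 y)^-1 * (f1 y)^-1) = - (f1 y) ^- 2.
    by rewrite mulN1r -invfM.
  rewrite -[_ * _]/(- (f1 y) ^- 2 *: 'D_(e i) f1 y) -deriveV ?f10 //.
  by apply: derivableP; apply: derivableV; rewrite ?f10.
Qed.

Lemma rational_continuous N h :
  (forall y k, N y -> {for y, continuous (fun z => h z 0 k)}) ->
  forall f, rational_in N h f -> forall y, N y -> {for y, continuous f}.
Proof.
move=> hc f Kf y Ny; have Kalg := @continuous_algebra R 'rV[R]_d y.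
elim: Kf => [c|k|f1 f2 _ IH1 _ IH2|f1 f2 _ IH1 _ IH2|f1 _ IH1 f10].
- exact: (algebra_cst Kalg).
- exact: hc.
- exact: (algebraD Kalg).
- exact: (algebraM Kalg).
- by apply: continuousV => //; exact: f10.
Qed.

(** By induction on the list of directions, each iterated partial derivative agrees on [N] with a
    row of rational expressions; as [N] is open, this agreement passes to derivatives. *)
Lemma smooth_rational N h : open N ->
  (forall y k, N y -> {for y, continuous (fun z => h z 0 k)}) ->
  (forall k i, exists2 g, rational_in N h g &
     forall y, N y -> is_derive y (e i) (fun z => h z 0 k) (g y)) ->
  smooth_open N h.
Proof.
move=> oN hc hD s.
have nbhsN y (f g : 'rV[R]_d -> 'rV[R]_d) :
    N y -> (forall z, N z -> f z = g z) -> {near y, f =1 g}.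
  by move=> Ny fg; near do apply: fg; exact: open_nbhs_nbhs.
have rowD (G : 'I_d -> 'rV[R]_d -> R) i : (forall k, rational_in N h (G k)) ->
    exists2 G' : 'I_d -> 'rV[R]_d -> R, (forall k, rational_in N h (G' k)) &
    forall y, N y -> is_derive y (e i) (fun z => \row_k G k z) (\row_k G' k y).
  move=> GK.
  have /choice[G' G'K] : forall k, exists g, rational_in N h g /\
      forall y, N y -> is_derive y (e i) (G k) (g y).
    by move=> k; have [g] := rational_derive hD (GK k) i; exists g.
  exists G' => [k|y Ny]; first by case: (G'K k).
  have dG : derivable (fun z => \row_k G k z) y (e i).
    apply/derivable_mxP => a k; under eq_fun do rewrite mxE.
    by case: (G'K k) => _ /(_ y Ny) [].
  apply: DeriveDef => //; rewrite derive_mx //; apply/rowP => k; rewrite !mxE.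
  by under eq_fun do rewrite mxE; case: (G'K k) => _ /(_ y Ny) [].
have [G GK hG] : exists2 G : 'I_d -> 'rV[R]_d -> R,
    (forall k, rational_in N h (G k)) &
    forall y, N y -> partials s h y = \row_k G k y.
  elim: s => [|i s [G GK hG]] /=.
    exists (fun k y => h y 0 k) => [k|y _]; first exact: rational_coord.
    by apply/rowP => k; rewrite mxE.
  have [G' G'K GG'] := rowD G i GK; exists G' => // y Ny.
  have [_ <-] := GG' y Ny; apply: near_eq_derive.
  exact: nbhsN.
move=> y Ny.
have Gh : {near y, (fun z => \row_k G k z) =1 partials s h}.
  by apply: nbhsN => // z Nz; rewrite hG.
split=> [|i].
  have cG : {for y, continuous (fun z => \row_k G k z)}.
    apply: continuous_mx => a k.
    have -> : (fun z => (\row_k G k z) a k) = G k.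
      by apply/funext => z; rewrite mxE.
    exact: (rational_continuous hc).
  suff : partials s h @ y --> partials s h y by [].
  by rewrite [X in _ --> X]hG //; exact: (cvg_trans (near_eq_cvg Gh) cG).
have [G' _ GG'] := rowD G i GK; have [dG _] := GG' y Ny.
exact: near_eq_derivable dG.
Unshelve. all: by end_near. Qed.

Variables (P : 'rV[R]_d -> 'rV[R]_d) (A : 'rV[R]_d -> 'rV[R]_d -> 'M[R]_d).
Hypothesis PA : forall x y, P x - P y = (x - y) *m A x y.
Hypothesis A_algebra : forall (T : Type) (K : (T -> R) -> Prop)
    (X Y : T -> 'rV[R]_d),
  function_algebra K -> (forall i, K (fun t => X t 0 i)) ->
  (forall i, K (fun t => Y t 0 i)) -> forall i j, K (fun t => A (X t) (Y t) i j).

(** The Lipschitz bound makes [h] continuous. Its difference quotients are then rows of inverses of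
    [A], which converge to a row of the inverse of [A (h y) (h y)], rational in [h] without poles on
    [N]. *)
Lemma smooth_inverse (W N : set 'rV[R]_d) h (c : R) : open N ->
  (forall y, N y -> W (h y) /\ P (h y) = y) ->
  (forall x y, W x -> W y -> A x y \in unitmx /\ `|x - y| <= c * `|P x - P y|) ->
  smooth_open N h.
Proof.
move=> oN hN hW.
have nN y : N y -> \near y, N y by move=> Ny; exact: open_nbhs_nbhs.
have ch y : N y -> {for y, continuous h}.
  move=> Ny; suff : h @ nbhs y --> h y by [].
  apply/(@cvgrPdist_le _ _ _ (nbhs y)) => eps eps0.
  have c1 : 0 < `|c| + 1 by rewrite ltr_wpDl.
  have nb : nbhs y (N `&` ball y (eps / (`|c| + 1))).
    by apply: filterI; [exact: nN | apply: nbhsx_ballx; rewrite divr_gt0].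
  apply: (@filterS _ (nbhs y) _ _ _ _ nb) => z [Nz].
  rewrite -ball_normE /= ltr_pdivlMr // mulrC => /ltW yz.
  have [Wy Py] := hN y Ny; have [Wz Pz] := hN z Nz.
  have [_] := hW _ _ Wy Wz; rewrite Py Pz => /le_trans; apply.
  apply: le_trans yz.
  by rewrite ler_wpM2r // (le_trans (ler_norm c)) // lerDl.
apply: smooth_rational => //.
  by move=> y k /ch hc; exact: continuous_entry.
move=> k i.
pose J y := (\det (A (h y) (h y)))^-1 *: \adj (A (h y) (h y)).
exists (fun y => J y i k).
  have Kalg := rational_algebra N h.
  have KA a b : rational_in N h (fun y => A (h y) (h y) a b).
    by apply: (A_algebra Kalg) => j; exact: rational_coord.
  apply: (algebra_invmx Kalg) => //; apply: rationalV.
    exact: (algebra_det Kalg).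
  move=> y /hN[Wy _]; have [+ _] := hW _ _ Wy Wy.
  by rewrite unitmxE unitfE.
move=> y Ny; have [Wy Py] := hN y Ny.
pose Q t : 'M[R]_d := A (h (t *: e i + y)) (h y).
pose q t := ((\det (Q t))^-1 *: \adj (Q t)) i k.
have q0 : q 0 = J y i k by rewrite /q /Q scale0r add0r.
have cl : {for (0 : R), continuous (fun t : R => t *: e i + y)}.
  apply: continuousD; last exact: cst_continuous.
  by apply: continuousZl; exact: cvg_id.
have cq : {for 0, continuous q}.
  have Kalg := @continuous_algebra R R 0.
  have KQ a b : {for 0, continuous (fun t => Q t a b)}.
    apply: (A_algebra Kalg) => j; last exact: (algebra_cst Kalg).
    apply: continuous_entry.
    apply: (@continuous_comp _ _ _ (fun t : R => t *: e i + y) h 0 cl).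
    by rewrite scale0r add0r; exact: ch.
  apply: (algebra_invmx Kalg) => //; apply: continuousV.
    rewrite /Q scale0r add0r; have [+ _] := hW _ _ Wy Wy.
    by rewrite unitmxE unitfE.
  exact: (algebra_det Kalg).
have dq : (fun t : R => t^-1 *: (((fun z => h z 0 k) \o shift y) (t *: e i) - h y 0 k))
    @ 0^' --> J y i k.
  rewrite -q0; apply: cvg_trans (cvg_within_filter _ cq) => //.
  apply: near_eq_cvg; near=> t.
  have t0 : t != 0 by near: t; exact: nbhs_dnbhs_neq.
  have Nt : N (t *: e i + y).
    near: t; apply: nbhs_dnbhs; apply: cl; rewrite scale0r add0r; exact: nN.
  have [Wt Pt] := hN _ Nt; have [uQ _] := hW _ _ Wt Wy.
  (* [PA] at the two values of [h] reads [t *: e i = (h (t *: e i + y) - h y) *m Q t]. *)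
  have : h (t *: e i + y) - h y = t *: (e i *m invmx (Q t)).
    rewrite -[LHS](mulmxK uQ) -PA Pt Py addrK.
    by rewrite scalemxAl.
  move=> /rowP/(_ k); rewrite invmxE // -rowE !mxE /= => ->.
  by rewrite -[_ *: _]/(t^-1 * _) mulKf // /q !mxE.
apply: DeriveDef; first by apply/cvg_ex; exists (J y i k).
exact: cvg_lim dq.
Unshelve. all: by end_near. Qed.

End SmoothInverse.

(** * Compactness of the domain, and passage from local inverses to the global one *)

Lemma compact_ref_domain (R : realType) d (U : domain_shape) :
  compact (@ref_domain R d U).
Proof.
have cc (i : 'I_d) : continuous (fun x : 'rV[R]_d => x 0 i).
  exact: coord_continuous.
have cge0 (i : 'I_d) : closed [set x : 'rV[R]_d | 0 <= x 0 i].
  by apply: (@closed_comp _ _ (fun x : 'rV[R]_d => x 0 i) [set t | 0 <= t]) => [x _|];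
    [exact: cc | exact: closed_ge].
have cle1 (g : 'rV[R]_d -> R) : continuous g -> closed [set x | g x <= 1].
  by move=> cg; apply: (@closed_comp _ _ g [set t | t <= 1]) => [x _|];
    [exact: cg | exact: closed_le].
have cforall (Q : 'I_d -> set 'rV[R]_d) : (forall i, closed (Q i)) ->
    closed [set x | forall i, Q i x].
  move=> cQ; have -> : [set x | forall i, Q i x] = \bigcap_i Q i.
    by apply/seteqP; split=> x Qx i; [move=> _|]; exact: Qx.
  exact: closed_bigI.
apply: bounded_closed_compact.
  exists 1; split=> // M /ltW M1 x Ux; apply: le_trans M1.
  apply: mx_norm_le => // a i.
  rewrite (ord1 a) ler_norml; case: U Ux => /= [x01|[x0 x1]].
    by have /andP[xi0 ->] := x01 i; rewrite (le_trans _ xi0) // oppr_le0.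
  rewrite (le_trans _ (x0 i)) ?oppr_le0 //=; apply: le_trans x1.
  by rewrite (bigD1 i) //= lerDl sumr_ge0.
case: U => /=.
  have E : [set x | forall i, ([set x : 'rV[R]_d | 0 <= x 0 i] `&`
      [set x | x 0 i <= 1]) x] = [set x | forall i, 0 <= x 0 i <= 1].
    by apply/seteqP; split=> x Ux i; apply/andP; exact: Ux i.
  rewrite -E; apply: cforall => i; apply: closedI; first exact: cge0.
  exact: cle1.
apply: (@closedI _ [set x : 'rV[R]_d | forall i, 0 <= x 0 i]
  [set x | \sum_i x 0 i <= 1]); first exact: cforall.
apply: cle1 => x; apply: (algebra_sum (@continuous_algebra R _ x)) => i _.
exact: cc.
Qed.

Theorem theorem4 (R : realType) (d : nat) (hd : d = 2%N \/ d = 3%N)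
    (U : domain_shape) (p : nat) (hp : (1 <= p)%N)
    (F : 'rV[R]_d -> 'rV[R]_d) (hF : polynomial_on U p F)
    (f : multi_index d p -> 'rV[R]_d) (hf : BB_control_points U F f)
    (hinv : forall u : 'I_d -> 'rV[R]_d,
      (forall j, hull [set` derivative_control_points U f j] (u j)) ->
      (\matrix_(i < d, j < d) u j 0 i) \in unitmx) :
  set_inj (ref_domain U) F /\
  exists G : 'rV[R]_d -> 'rV[R]_d,
    (forall x, ref_domain U x -> G (F x) = x) /\
    smooth_on (F @` ref_domain U) G.
Proof.
(* [P] is the polynomial extension of [F], whose values off the domain are arbitrary. *)
pose P x : 'rV[R]_d := blossom (steps d U p) x (net f) (fun=> 0%N).
pose A x y : 'M[R]_d :=
  \matrix_(j < d) divdiff (steps d U p) x y j (net f) (fun=> 0%N).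
have FP x : ref_domain U x -> F x = P x.
  by move=> Ux; rewrite hf // /P blossom_steps.
have PA x y : P x - P y = (x - y) *m A x y.
  rewrite /P blossomB mulmx_sum_row; apply: eq_bigr => j _.
  by rewrite rowK !mxE.
have A_algebra (T : Type) (K : (T -> R) -> Prop) (X Y : T -> 'rV[R]_d) :
    function_algebra K -> (forall i, K (fun t => X t 0 i)) ->
    (forall i, K (fun t => Y t 0 i)) ->
    forall i j, K (fun t => A (X t) (Y t) i j).
  move=> Kalg KX KY i j.
  have -> : (fun t => A (X t) (Y t) i j) =
      (fun t => divdiff (steps d U p) (X t) (Y t) i (net f) (fun=> 0%N) 0 j).
    by apply/funext => t; rewrite mxE.
  exact: algebra_divdiff.
have A_unit x y : ref_domain U x -> ref_domain U y -> A x y \in unitmx.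
  move=> Ux Uy; pose u j := divdiff (steps d U p) x y j (net f) (fun=> 0%N).
  (* The hypothesis puts the vectors in columns, [A] in rows. *)
  have -> : A x y = (\matrix_(i < d, j < d) u j 0 i)^T.
    by apply/matrixP => i j; rewrite !mxE.
  by rewrite unitmx_tr; apply: hinv => j; exact: hull_divdiff.
have PB x y : ref_domain U x -> ref_domain U y ->
    x - y = (P x - P y) *m invmx (A x y).
  by move=> Ux Uy; rewrite PA mulmxK // A_unit.
have F_inj : set_inj (ref_domain U) F.
  move=> x y; rewrite !inE => Ux Uy Fxy; apply/eqP.
  by rewrite -subr_eq0 PB // -!FP // Fxy subrr mul0mx.
split=> //; pose G y := xget 0 [set x | ref_domain U x /\ F x = y].
have GF x : ref_domain U x -> G (F x) = x.
  move=> Ux; rewrite /G; case: xgetP => [z _ [Uz Fzx]|/(_ x)[] //].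
  by apply: F_inj; rewrite ?inE.
exists G; split=> // _ [x0 Ux0 <-]; rewrite FP //.
(* This keeps points of the domain far from [x0] from having images near [P x0]; local inversion
   alone does not exclude them. *)
have [M M0 PM] : exists2 M, 0 <= M & forall x, ref_domain U x ->
    `|x - x0| <= M * `|P x - P x0|.
  pose Q x : 'M[R]_d := (\det (A x x0))^-1 *: \adj (A x x0).
  have cQ : {within ref_domain U, continuous Q}.
    apply: continuous_in_subspaceT => x; rewrite inE => Ux.
    apply: continuous_mx => i j; have Kalg := @continuous_algebra R _ x.
    have KA k l : {for x, continuous (fun z => A z x0 k l)}.
      apply: (A_algebra _ _ _ _ Kalg) => m; last exact: (algebra_cst Kalg).
      exact: coord_continuous.
    apply: (algebra_invmx Kalg) => //; apply: continuousV.
      by have := A_unit _ _ Ux Ux0; rewrite unitmxE unitfE.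
    exact: (algebra_det Kalg).
  have /compact_bounded[M [_ QM]] :=
    continuous_compact cQ (@compact_ref_domain R d U).
  (* [M] is a threshold of unknown sign above which every number bounds [Q]. *)
  exists (d%:R * `|M + 1|) => [|x Ux]; first by rewrite mulr_ge0.
  rewrite PB // (le_trans (mulmx_norm_le _ _)) //.
  rewrite ler_wpM2r // ler_wpM2l // (le_trans _ (ler_norm (M + 1))) //.
  by rewrite invmxE ?A_unit //; apply: QM; [rewrite ltrDl | exists x].
have [r [N [h [r0 oN Nx0 hN hr]]]] := local_inverse PA A_algebra (A_unit _ _ Ux0 Ux0).
(* The radius forces |x - x0| <= r for every [x] of the domain with [F x] in [B]; adding 1 makes the
   denominator positive. *)
pose B := ball (P x0) (r / (M + 1)).
have M1 : 0 < M + 1 by rewrite ltr_wpDl.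
exists (N `&` B), h; split.
- by apply: openI => //; exact: ball_open.
- by split=> //; apply: ballxx; rewrite divr_gt0.
- pose c := 2 * (d%:R * `|invmx (A x0 x0)|).
  apply: (@smooth_inverse _ _ P A PA A_algebra [set x | `|x - x0| <= r] _ _ c).
  + by apply: openI => //; exact: ball_open.
  + by move=> y [Ny _]; exact: hN.
  + move=> x y /= xr yr; have [uA xy] := hr x y xr yr; split=> //.
    rewrite (le_trans xy) // /c -mulrA ler_wpM2l //.
    exact: mulmx_norm_le.
- move=> y; rewrite inE => -[[x Ux <-] [Nx]].
  rewrite GF // FP // /B -ball_normE /= distrC ltr_pdivlMr // => xr.
  have [hxr Phx] := hN _ Nx; rewrite FP // in Nx hxr Phx.
  have xr' : `|x - x0| <= r.
    rewrite (le_trans (PM _ Ux)) // (le_trans _ (ltW xr)) // mulrC.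
    by rewrite ler_wpM2l // lerDl.
  (* Both [x] and [h (P x)] lie in the ball of radius [r] around [x0] and have the same image, so
     the local bound makes them equal. *)
  have [_] := hr _ _ xr' hxr; rewrite Phx subrr mul0mx normr0 mulr0.
  by rewrite normr_le0 subr_eq0 => /eqP.
Qed.
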